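(* Let $0<\varepsilon\le 1$. Suppose $S \subseteq \Omega$ is such that every pair $(x,y)\in S\times\Omega$ is $\varepsilon$ distance-decreasing, and $$\pi(S) \ge 1 - \frac{\varepsilon}{16\,\operatorname{diam}(\Omega)}.$$ Let $X_0\in\Omega$, let $\delta>0$, and let $T$ be an integer number of steps with $$T \ge \frac{\lceil \ln(32\,\operatorname{diam}(\Omega))\rceil\,\lceil \ln(1/\delta)\rceil}{\varepsilon}.$$ Then $\|X_T-\pi\|_{\mathrm{TV}}\le\delta$, where $X_T$ is the state of the Markov chain after $T$ steps started from $X_0$.
   Context: $\Omega$ is a finite set carrying a (time-homogeneous) Markov chain with a unique stationary distribution $\pi$. $\rho$ is an arbitrary integer-valued metric on $\Omega$, and $\operatorname{diam}(\Omega)=\max_{x,y\in\Omega}\rho(x,y)$. A (one-step) coupling specifies, for every pair $(X_t,Y_t)\in\Omega^2$, a joint distribution for $(X_{t+1},Y_{t+1})$ such that $X_t\to X_{t+1}$ and $Y_t\to Y_{t+1}$ each behave according to the Markov chain. A pair $(x,y)\in\Omega^2$ is $\varepsilon$ distance-decreasing if there exists a coupling such that $\mathbf{E}(\rho(X_1,Y_1)\mid X_0=x,Y_0=y)\le(1-\varepsilon)\rho(x,y)$. For distributions $\mu,\nu$ on $\Omega$, $\|\mu-\nu\|_{\mathrm{TV}}=\frac12\sum_{x\in\Omega}|\mu(x)-\nu(x)|$; writing $\|X-\nu\|_{\mathrm{TV}}$ for a random variable $X$ refers to the distribution of $X$. *)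

(* Defs.v *)
From HB Require Import structures.
From mathcomp Require Import all_boot all_order all_algebra.
From mathcomp Require Import reals exp.

Set Implicit Arguments.
Unset Strict Implicit.
Unset Printing Implicit Defensive.

Import Order.TTheory GRing.Theory Num.Theory.
Local Open Scope ring_scope.

Definition is_distr (R : realType) (T : finType) (mu : {ffun T -> R}) : Prop :=
  (forall x, 0 <= mu x) /\ \sum_x mu x = 1.

Definition TV (R : realType) (T : finType) (mu nu : {ffun T -> R}) : R :=
  2^-1 * \sum_x `|mu x - nu x|.

(* [P x] is the law of the next state from [x]. *)
Definition is_markov_chain (R : realType) (Omega : finType)
    (P : Omega -> {ffun Omega -> R}) : Prop :=
  forall x, is_distr (P x).

Definition step (R : realType) (Omega : finType)
    (P : Omega -> {ffun Omega -> R}) (mu : {ffun Omega -> R}) :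
    {ffun Omega -> R} :=
  [ffun y => \sum_x mu x * P x y].

Definition dirac_distr (R : realType) (Omega : finType) (x0 : Omega) :
    {ffun Omega -> R} :=
  [ffun x => (x == x0)%:R].

(* The distribution of X_t, for the chain started from X_0 = x0. *)
Definition law (R : realType) (Omega : finType)
    (P : Omega -> {ffun Omega -> R}) (x0 : Omega) (t : nat) :
    {ffun Omega -> R} :=
  iter t (step P) (dirac_distr R x0).

Definition is_stationary (R : realType) (Omega : finType)
    (P : Omega -> {ffun Omega -> R}) (mu : {ffun Omega -> R}) : Prop :=
  is_distr mu /\ step P mu = mu.

Definition is_unique_stationary (R : realType) (Omega : finType)
    (P : Omega -> {ffun Omega -> R}) (pi : {ffun Omega -> R}) : Prop :=
  is_stationary P pi /\ forall mu, is_stationary P mu -> mu = pi.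

(* Metrics are nonnegative, so an integer-valued one takes values in [nat]. *)
Definition is_metric (Omega : finType) (rho : Omega -> Omega -> nat) : Prop :=
  [/\ forall x y, rho x y = 0%N <-> x = y,
      forall x y, rho x y = rho y x
    & forall x y z, (rho x z <= rho x y + rho y z)%N].

Definition diam (Omega : finType) (rho : Omega -> Omega -> nat) : nat :=
  \max_(x : Omega) \max_(y : Omega) rho x y.

(* [K x y] is the joint law of (X_1, Y_1) given (X_0, Y_0) = (x, y). *)
Definition is_coupling (R : realType) (Omega : finType)
    (P : Omega -> {ffun Omega -> R})
    (K : Omega -> Omega -> {ffun Omega * Omega -> R}) : Prop :=
  forall x y,
    [/\ is_distr (K x y),
        forall x', \sum_y' K x y (x', y') = P x x'
      & forall y', \sum_x' K x y (x', y') = P y y'].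

Definition distance_decreasing (R : realType) (Omega : finType)
    (P : Omega -> {ffun Omega -> R}) (rho : Omega -> Omega -> nat)
    (eps : R) (x y : Omega) : Prop :=
  exists2 K : Omega -> Omega -> {ffun Omega * Omega -> R},
    is_coupling P K &
    \sum_(p : Omega * Omega) K x y p * (rho p.1 p.2)%:R
      <= (1 - eps) * (rho x y)%:R.

(* Main.v *)
(** Couple X_t with a stationary copy Y_t.  A step from Y_t in S contracts the
    expected distance by 1 - eps, and the steps from outside S cost at most
    diam * pi(~ S) <= eps / 16, so the expected distance after t steps is at
    most (1 - eps)^t diam + 1/16.  With s = floor (ceil (ln (32 diam)) / eps)
    this is at most e/32 + 1/16; it bounds the total variation distance to pi
    from any starting point, hence two starting points give laws at distance at
    most c = e/16 + 1/8 <= 1/e.  Each further block of s steps then multiplies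
    the total variation distance to pi by at most c, and T contains
    ceil (ln (1 / delta)) such blocks. *)
Require Import Defs.
From HB Require Import structures.
From mathcomp Require Import all_boot all_order all_algebra.
From mathcomp Require Import reals exp.
From mathcomp Require Import sequences ring lra.

Set Implicit Arguments.
Unset Strict Implicit.
Unset Printing Implicit Defensive.

Import Order.TTheory GRing.Theory Num.Theory.
Local Open Scope ring_scope.

(** * Total variation and the action of the chain on distributions *)

Section TotalVariation.
Variables (R : realType) (Omega : finType).
Implicit Types (mu nu : {ffun Omega -> R}) (P : Omega -> {ffun Omega -> R}).

Lemma TV_sym mu nu : TV mu nu = TV nu mu.
Proof. by congr (_ * _); apply: eq_bigr => x _; rewrite distrC. Qed.

Lemma TV_triangle mu nu xi : TV mu xi <= TV mu nu + TV nu xi.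
Proof.
rewrite /TV -mulrDr ler_wpM2l ?invr_ge0 ?ler0n// -big_split.
by apply: ler_sum => x _; apply: ler_distD.
Qed.

Lemma TV_le1 mu nu : is_distr mu -> is_distr nu -> TV mu nu <= 1.
Proof.
move=> [mu0 mu1] [nu0 nu1].
suff: \sum_x `|mu x - nu x| <= 2 by rewrite /TV; lra.
have -> : 2 = \sum_x (mu x + nu x) by rewrite big_split /= mu1 nu1; ring.
apply: ler_sum => x _.
by rewrite (le_trans (ler_normB _ _))// !ger0_norm.
Qed.

Lemma dirac_distrP (x0 : Omega) : is_distr (dirac_distr R x0).
Proof.
split=> [x|]; first by rewrite ffunE ler0n.
rewrite (bigD1 x0)//= ffunE eqxx big1 ?addr0// => x /negPf.
by rewrite ffunE => ->.
Qed.

Lemma step_distr P mu : is_markov_chain P -> is_distr mu -> is_distr (step P mu).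
Proof.
move=> hP [mu0 mu1]; split=> [y|].
  by rewrite ffunE sumr_ge0// => x _; rewrite mulr_ge0//; case: (hP x).
under eq_bigr do rewrite ffunE.
rewrite exchange_big -{}mu1; apply: eq_bigr => x _ /=.
by rewrite -mulr_sumr; case: (hP x) => _ ->; rewrite mulr1.
Qed.

Lemma iter_step_distr P mu n :
  is_markov_chain P -> is_distr mu -> is_distr (iter n (step P) mu).
Proof. by move=> hP hmu; elim: n => //= n; apply: step_distr. Qed.

(** Evolution is linear in the initial law, so a run from [mu] is the mixture of the runs from point
    masses. *)
Lemma iter_step_law P mu n z :
  iter n (step P) mu z = \sum_x mu x * law P x n z.
Proof.
elim: n z => [|n IHn] z /=.
  by rewrite (bigD1 z)//= ffunE eqxx mulr1 big1 ?addr0// => x /negPf;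
    rewrite ffunE eq_sym => ->; rewrite mulr0.
rewrite ffunE; transitivity (\sum_y \sum_x mu x * law P x n y * P y z).
  by apply: eq_bigr => y _; rewrite IHn mulr_suml.
rewrite exchange_big; apply: eq_bigr => x _ /=.
by rewrite ffunE mulr_sumr; apply: eq_bigr => y _; rewrite mulrA.
Qed.

(* With d = mu - nu and m the common mass of d^+ and d^-, the signed measure
   m (d Q) is the combination of the Q x - Q y with weights d^+ x * d^- y. *)
Lemma TV_iter_contract P mu nu n (c : R) :
  is_distr mu -> is_distr nu ->
  (forall x y, TV (law P x n) (law P y n) <= c) ->
  TV (iter n (step P) mu) (iter n (step P) nu) <= c * TV mu nu.
Proof.
move=> [mu0 mu1] [nu0 nu1] hc.
pose dp x := (`|mu x - nu x| + (mu x - nu x)) / 2.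
pose dm x := (`|mu x - nu x| - (mu x - nu x)) / 2.
have dp0 x : 0 <= dp x by rewrite divr_ge0// -lerBlDr sub0r ler_normr lexx orbT.
have dm0 x : 0 <= dm x by rewrite divr_ge0// subr_ge0 ler_norm.
have dE x : mu x - nu x = dp x - dm x by rewrite /dp /dm; field.
have dN x : `|mu x - nu x| = dp x + dm x by rewrite /dp /dm; field.
pose m := \sum_x dp x.
(* Both laws have total mass 1, so the two parts of their difference have equal mass. *)
have mE : \sum_x dm x = m.
  have : \sum_x (mu x - nu x) = 0 by rewrite sumrB mu1 nu1 subrr.
  by under eq_bigr do rewrite dE; rewrite sumrB => /subr0_eq.
have TVm : TV mu nu = m.
  by rewrite /TV; under eq_bigr do rewrite dN; rewrite big_split /= mE -/m; field.
have m0 : 0 <= m by apply: sumr_ge0.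
have DE z : iter n (step P) mu z - iter n (step P) nu z =
    \sum_x dp x * law P x n z - \sum_x dm x * law P x n z.
  rewrite !iter_step_law -!sumrB; apply: eq_bigr => x _.
  by rewrite -mulrBl dE mulrBl.
(* The inequality is about to be multiplied by [m], so [m = 0] is treated apart: both parts then
   vanish pointwise. *)
rewrite TVm; case: (ltrgt0P m) m0 => // [m_gt0 _|m_eq0 _]; last first.
  have dp00 x : dp x = 0.
    by apply/eqP; move/eqP: m_eq0; rewrite psumr_eq0// => /allP/(_ x); apply;
      rewrite mem_index_enum.
  have dm00 x : dm x = 0.
    by apply/eqP; move: mE => /eqP; rewrite m_eq0 psumr_eq0// => /allP/(_ x);
      apply; rewrite mem_index_enum.
  rewrite m_eq0 mulr0 /TV big1 ?mulr0// => z _.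
  by rewrite DE !big1 ?subrr ?normr0// => x _; rewrite ?dp00 ?dm00 mul0r.
rewrite -(ler_pM2l m_gt0).
have mD z : m * `|iter n (step P) mu z - iter n (step P) nu z| <=
    \sum_x \sum_y dp x * dm y * `|law P x n z - law P y n z|.
  rewrite -{1}(ger0_norm (ltW m_gt0)) -normrM.
  have -> : m * (iter n (step P) mu z - iter n (step P) nu z) =
      \sum_x \sum_y dp x * dm y * (law P x n z - law P y n z).
    rewrite DE mulrBr mulrC -[in X in X - _]mE big_distrlr big_distrlr -sumrB.
    apply: eq_bigr => x _; rewrite -sumrB; apply: eq_bigr => y _ /=; ring.
  apply: (le_trans (ler_norm_sum _ _ _)); apply: ler_sum => x _.
  apply: (le_trans (ler_norm_sum _ _ _)); apply: ler_sum => y _.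
  by rewrite normrM ger0_norm// mulr_ge0.
have -> : m * (c * m) = \sum_x \sum_y dp x * dm y * c.
  rewrite mulrCA mulrC -[X in m * X * _]mE big_distrlr mulr_suml.
  by apply: eq_bigr => x _; rewrite mulr_suml.
rewrite /TV mulrCA mulr_sumr.
apply: (@le_trans _ _ (2^-1 * \sum_z \sum_x \sum_y
    dp x * dm y * `|law P x n z - law P y n z|)).
  by rewrite ler_wpM2l ?invr_ge0 ?ler0n//; apply: ler_sum.
rewrite exchange_big mulr_sumr; apply: ler_sum => x _.
rewrite exchange_big mulr_sumr; apply: ler_sum => y _.
rewrite -mulr_sumr mulrCA; apply: ler_wpM2l; last exact: hc.
by apply: mulr_ge0.
Qed.

End TotalVariation.

(** * Joint laws and their expected distance *)

Section Coupling.
Variables (R : realType) (Omega : finType).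
Implicit Types (mu nu : {ffun Omega -> R}) (J : {ffun Omega * Omega -> R}).

Definition joint_law mu nu J : Prop :=
  [/\ forall p, 0 <= J p,
      forall x, \sum_y J (x, y) = mu x
    & forall y, \sum_x J (x, y) = nu y].

Definition mean_dist (rho : Omega -> Omega -> nat) J : R :=
  \sum_p J p * (rho p.1 p.2)%:R.

Lemma joint_law_fst mu nu J (f : Omega -> R) :
  joint_law mu nu J -> \sum_p J p * f p.1 = \sum_x mu x * f x.
Proof.
case=> _ J1 _; transitivity (\sum_x \sum_y J (x, y) * f x).
  by rewrite pair_bigA; apply: eq_bigr => -[].
by apply: eq_bigr => x _; rewrite -mulr_suml J1.
Qed.

Lemma joint_law_snd mu nu J (f : Omega -> R) :
  joint_law mu nu J -> \sum_p J p * f p.2 = \sum_x nu x * f x.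
Proof.
case=> _ _ J2; transitivity (\sum_x \sum_y J (x, y) * f y).
  by rewrite pair_bigA; apply: eq_bigr => -[].
rewrite exchange_big.
by apply: eq_bigr => x _; rewrite -mulr_suml J2.
Qed.

Lemma product_joint_law mu nu : is_distr mu -> is_distr nu ->
  joint_law mu nu [ffun p => mu p.1 * nu p.2].
Proof.
move=> [mu0 mu1] [nu0 nu1]; split=> [p|x|y].
- by rewrite ffunE mulr_ge0.
- by under eq_bigr do rewrite ffunE /=; rewrite -mulr_sumr nu1 mulr1.
- by under eq_bigr do rewrite ffunE /=; rewrite -mulr_suml mu1 mul1r.
Qed.

(** By convexity of total variation it suffices to compare point masses, and distinct points are at
    distance at least 1 because [rho] is integer-valued. *)
Lemma TV_le_mean_dist rho mu nu J :
  is_metric rho -> joint_law mu nu J -> TV mu nu <= mean_dist rho J.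
Proof.
move=> [rho0 _ _] hJ; have [J0 _ _] := hJ.
(* The decomposition into point masses is [iter_step_law] at zero steps, with a placeholder
   kernel. *)
have dirac_fst z : mu z = \sum_p J p * dirac_distr R p.1 z.
  rewrite (joint_law_fst (fun x => dirac_distr R x z) hJ).
  exact: (iter_step_law (fun=> mu) mu 0).
have dirac_snd z : nu z = \sum_p J p * dirac_distr R p.2 z.
  rewrite (joint_law_snd (fun x => dirac_distr R x z) hJ).
  exact: (iter_step_law (fun=> nu) nu 0).
apply: (@le_trans _ _ (\sum_p J p * TV (dirac_distr R p.1) (dirac_distr R p.2))).
  rewrite /TV; under [leRHS]eq_bigr do rewrite mulrCA.
  rewrite -mulr_sumr ler_wpM2l ?invr_ge0 ?ler0n//.
  under [leRHS]eq_bigr do rewrite mulr_sumr.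
  rewrite exchange_big; apply: ler_sum => z _ /=.
  rewrite dirac_fst dirac_snd -sumrB (le_trans (ler_norm_sum _ _ _))//.
  by apply: ler_sum => p _; rewrite -mulrBr normrM ger0_norm.
apply: ler_sum => -[x y] _ /=; rewrite ler_wpM2l//.
have [<-|xy] := eqVneq x y.
  by rewrite /TV big1 ?mulr0// => z _; rewrite subrr normr0.
rewrite (le_trans (TV_le1 (dirac_distrP _ _) (dirac_distrP _ _)))// ler1n lt0n.
by apply: contra_neq xy => /rho0.
Qed.

(** Draw a pair [p] from [J], then move it by [K p]: each marginal of [K p] depends only on its own
    coordinate of [p], so averaging gives one step of the chain. *)
Lemma glue_joint_law (P : Omega -> {ffun Omega -> R}) mu nu J
    (K : Omega * Omega -> {ffun Omega * Omega -> R}) :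
  joint_law mu nu J -> (forall p, joint_law (P p.1) (P p.2) (K p)) ->
  joint_law (step P mu) (step P nu) [ffun q => \sum_p J p * K p q].
Proof.
move=> hJ hK; have [J0 _ _] := hJ; split=> [q|x|y].
- by rewrite ffunE sumr_ge0// => p _; rewrite mulr_ge0//; case: (hK p).
- under eq_bigr do rewrite ffunE.
  rewrite exchange_big ffunE -(joint_law_fst (P^~ x) hJ).
  by apply: eq_bigr => p _; rewrite -mulr_sumr; case: (hK p) => _ ->.
- under eq_bigr do rewrite ffunE.
  rewrite exchange_big ffunE -(joint_law_snd (P^~ y) hJ).
  by apply: eq_bigr => p _; rewrite -mulr_sumr; case: (hK p) => _ _ ->.
Qed.

Lemma mean_dist_glue rho J (K : Omega * Omega -> {ffun Omega * Omega -> R}) :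
  mean_dist rho [ffun q => \sum_p J p * K p q] =
  \sum_p J p * mean_dist rho (K p).
Proof.
rewrite /mean_dist; under eq_bigr do rewrite ffunE mulr_suml.
rewrite exchange_big; apply: eq_bigr => p _ /=.
by rewrite mulr_sumr; apply: eq_bigr => q _; rewrite mulrA.
Qed.

Lemma rho_le_diam (rho : Omega -> Omega -> nat) x y : (rho x y <= diam rho)%N.
Proof.
rewrite /diam (leq_trans _ (leq_bigmax x))//.
exact: (leq_bigmax (F := fun z => rho x z)).
Qed.

Lemma mean_dist_le_diam rho mu nu J :
  is_distr mu -> joint_law mu nu J -> mean_dist rho J <= (diam rho)%:R.
Proof.
move=> [_ mu1] hJ; have [J0 _ _] := hJ.
have <- : \sum_p J p * (diam rho)%:R = (diam rho)%:R.
  by rewrite (joint_law_fst (fun=> (diam rho)%:R) hJ) -mulr_suml mu1 mul1r.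
by apply: ler_sum => p _; rewrite ler_wpM2l// ler_nat rho_le_diam.
Qed.

(** * Coupling the chain with a stationary copy *)

Section DistanceDecreasing.
Variables (P : Omega -> {ffun Omega -> R}) (pi : {ffun Omega -> R}).
Variables (rho : Omega -> Omega -> nat) (eps : R) (S : {set Omega}).
Hypothesis hP : is_markov_chain P.
Hypothesis hpi : is_stationary P pi.
Hypothesis heps1 : eps <= 1.
Hypothesis hS : forall x y, x \in S -> distance_decreasing P rho eps x y.

(* Outside S the independent coupling is used: it costs at most the diameter. *)
Lemma one_step_coupling (p : Omega * Omega) :
  exists J, joint_law (P p.1) (P p.2) J /\
    mean_dist rho J <= (1 - eps) * (rho p.1 p.2)%:R
                       + (p.1 \notin S)%:R * (diam rho)%:R.
Proof.
have [pS|pS] /= := boolP (p.1 \in S).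
  have [K hK hE] := hS p.2 pS; exists (K p.1 p.2).
  by have [[K0 _] K1 K2] := hK p.1 p.2; split=> //; rewrite mul0r addr0.
exists [ffun q => P p.1 q.1 * P p.2 q.2].
have hJ := product_joint_law (hP p.1) (hP p.2); split=> //.
rewrite mul1r (le_trans (mean_dist_le_diam rho (hP p.1) hJ))// lerDr.
by rewrite mulr_ge0// subr_ge0.
Qed.

(** The stationary copy is the first coordinate, the one that [hS] restricts to [S]; the penalty for
    lying outside [S] then averages to the diameter times the mass of [pi] off [S]. *)
Lemma stationary_coupling_step nu J : joint_law pi nu J ->
  exists J', joint_law pi (step P nu) J' /\
    mean_dist rho J' <= (1 - eps) * mean_dist rho J
                        + (diam rho)%:R * (1 - \sum_(x in S) pi x).
Proof.
(* The one-step couplings are found pair by pair; finite choice assembles them into one kernel. *)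
move=> hJ; have [K hK] := fin_all_exists one_step_coupling.
have [[pi0 pi1] piP] := hpi; have [J0 _ _] := hJ.
exists [ffun q => \sum_p J p * K p q]; split.
  by rewrite -{1}piP; apply: glue_joint_law => // p; case: (hK p).
have -> : 1 - \sum_(x in S) pi x = \sum_x pi x * (x \notin S)%:R.
  rewrite -[X in X - _ = _]pi1 (bigID (mem S)) /= addrAC subrr add0r.
  rewrite big_mkcond; apply: eq_bigr => x _ /=.
  by case: (x \in S); rewrite ?mulr0 ?mulr1.
rewrite -(joint_law_fst (fun x => (x \notin S)%:R) hJ) mean_dist_glue.
rewrite !mulr_sumr -big_split; apply: ler_sum => p _ /=.
have [_ /(ler_wpM2l (J0 p)) h] := hK p; apply: (le_trans h).
lra.
Qed.

(** The expected distance e obeys e' <= (1 - eps) e + eps b, whose fixed point is [b]; only the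
    excess over [b] has to decay. *)
Lemma stationary_coupling (X0 : Omega) (b : R) t :
  0 <= b -> (diam rho)%:R * (1 - \sum_(x in S) pi x) <= eps * b ->
  exists J, joint_law pi (law P X0 t) J /\
    mean_dist rho J <= (1 - eps) ^+ t * (diam rho)%:R + b.
Proof.
move=> b0 hb; have [hpid _] := hpi.
elim: t => [|t [J [hJ hE]]].
  have hJ := product_joint_law hpid (dirac_distrP R X0); eexists; split.
    exact: hJ.
  by rewrite mul1r (le_trans (mean_dist_le_diam rho hpid hJ))// lerDl.
have [J' [hJ' hE']] := stationary_coupling_step hJ.
exists J'; split=> //; apply: (le_trans hE').
have := ler_wpM2l _ hE; move/(_ (1 - eps)); rewrite subr_ge0 => /(_ heps1).
rewrite exprS -mulrA; move: (_ ^+ t * _) => u hu; lra.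
Qed.

End DistanceDecreasing.
End Coupling.

(** * Numerical estimates and the mixing time *)

(** From 1 - 1/5 <= exp(-1/5) follows exp(1/5) <= 5/4, and (5/4)^5 < 3.1. The value 3.1 is small
    enough for e^2 + 2e <= 16, needed for contraction by 1/e. *)
Lemma expR1_le (R : realType) : expR 1 <= 31 / 10 :> R.
Proof.
have h : expR (5^-1) <= 5 / 4 :> R.
  have := expR_ge1Dx (- 5^-1 : R); rewrite expRN => h.
  have e0 := expR_gt0 (5^-1 : R).
  have := ler_wpM2r (ltW e0) h; rewrite mulVf ?gt_eqF//; lra.
have h5 : expR (5^-1) ^+ 5 <= (5 / 4) ^+ 5 :> R.
  by apply: lerXn2r; rewrite ?nnegrE ?expR_ge0//; lra.
have h1 : 5^-1 * 5%:R = 1 :> R by rewrite mulVf ?pnatr_eq0.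
by rewrite -expRM_natr h1 in h5; apply: (le_trans h5); lra.
Qed.

(* The step number is rounded down, so that k blocks of it fit into k times the
   unrounded time; this loses at most a factor e. *)
Lemma geometric_decay (R : realType) (eps d : R) : 0 < eps -> eps <= 1 -> 1 <= d ->
  (1 - eps) ^+ Num.truncn ((Num.ceil (ln (32 * d)))%:~R / eps) * d
    <= expR 1 / 32.
Proof.
move=> eps0 eps1 d1; set L := _%:~R; set s := Num.truncn _.
have d0 : 0 < d by apply: lt_le_trans d1.
(* Rounding down leaves the exponent short of [L] by at most [eps] <= 1. *)
have sL : L - eps <= eps * s%:R.
  have := truncnS_gt (L / eps).
  by rewrite -/s ltr_pdivrMr// -natr1 => /ltW; lra.
have LlN : ln (32 * d) <= L := ceil_ge _.
rewrite -ler_pdivlMr//.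
apply: (@le_trans _ _ (expR (- eps) ^+ s)).
  by apply: lerXn2r; rewrite ?nnegrE ?expR_ge0 ?subr_ge0//; apply: expR_ge1Dx.
rewrite -expRM_natr.
have -> : expR 1 / 32 / d = expR (1 - ln (32 * d)).
  by rewrite expRB lnK ?posrE ?mulr_gt0// invfM mulrA.
by rewrite ler_expR; lra.
Qed.

Theorem theorem1p2 (R : realType) (Omega : finType)
    (P : Omega -> {ffun Omega -> R}) (pi : {ffun Omega -> R})
    (rho : Omega -> Omega -> nat) (eps : R) (S : {set Omega})
    (X0 : Omega) (delta : R) (T : nat)
    (hP : is_markov_chain P)
    (hpi : is_unique_stationary P pi)
    (hrho : is_metric rho)
    (heps0 : 0 < eps) (heps1 : eps <= 1)
    (hS : forall x y, x \in S -> distance_decreasing P rho eps x y)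
    (hpiS : \sum_(x in S) pi x >= 1 - eps / (16 * (diam rho)%:R))
    (hdelta : 0 < delta)
    (hT : T%:R >= (Num.ceil (ln (32 * (diam rho)%:R : R)))%:~R
                  * (Num.ceil (ln (1 / delta)))%:~R / eps) :
  TV (law P X0 T) pi <= delta.
Proof.
have [hst _] := hpi; have [hpid piP] := hst.
have hlaw t := iter_step_distr t hP (dirac_distrP R X0).
(* Once [delta] < 1, the ceiling of ln (1 / delta) is positive and can count blocks. *)
have [delta1|delta1] := leP 1 delta; first exact: (le_trans (TV_le1 (hlaw T) hpid) delta1).
(* At diameter 0 the logarithm and the inverse in [hT] and [hpiS] take default values; total
   variation is instead bounded directly by the diameter. *)
have [d0|d_gt0] := posnP (diam rho).
  have hJ := product_joint_law (hlaw T) hpid.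
  rewrite (le_trans (TV_le_mean_dist hrho hJ))//.
  by rewrite (le_trans (mean_dist_le_diam rho (hlaw T) hJ))// d0 ltW.
set d : R := (diam rho)%:R in hpiS hT *.
have d1 : 1 <= d by rewrite ler1n.
set L := Num.ceil (ln (32 * d)) in hT.
pose s := Num.truncn (L%:~R / eps : R).
pose c : R := 2 * (expR 1 / 32 + 16^-1).
have hmix x : TV (law P x s) pi <= c / 2.
  (* The assumed mass of [S] is exactly what admits [b] = 1/16. *)
  have hb : d * (1 - \sum_(x in S) pi x) <= eps * 16^-1.
    have : d * (1 - \sum_(x in S) pi x) <= d * (eps / (16 * d)).
      by rewrite ler_wpM2l; lra.
    have dN0 : d != 0 by rewrite gt_eqF// (lt_le_trans _ d1).
    by rewrite (_ : d * (eps / (16 * d)) = eps * 16^-1)//; field.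
  have b0 : 0 <= 16^-1 :> R by lra.
  have [J [hJ hE]] := stationary_coupling hP hst heps1 hS x s b0 hb.
  rewrite TV_sym (le_trans (TV_le_mean_dist hrho hJ))// (le_trans hE)//.
  have := geometric_decay heps0 heps1 d1; rewrite -/L -/s -/d /c; lra.
have hpair x y : TV (law P x s) (law P y s) <= c.
  have := TV_triangle (law P x s) pi (law P y s).
  by have := hmix x; have := hmix y; rewrite [TV pi _]TV_sym; lra.
(* Any initial law is allowed, so that leftover steps can precede the blocks; [pi] is its own image
   under each block. *)
have iter_contract mu k : is_distr mu ->
    TV (iter (k * s) (step P) mu) pi <= c ^+ k.
  move=> hmu; elim: k => [|k IHk]; first exact: TV_le1.
  have pis n : iter n (step P) pi = pi by elim: n => //= n ->.
  rewrite mulSn iterD -(pis s) exprS.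
  apply: (le_trans (TV_iter_contract _ hpid hpair)); last first.
    by rewrite ler_wpM2l// /c; have := expR_ge0 (1 : R); lra.
  exact: iter_step_distr.
have lnd0 : 0 < ln (1 / delta) by rewrite ln_gt0// div1r invf_gt1.
pose k := `|Num.ceil (ln (1 / delta))|%N.
have kE : (Num.ceil (ln (1 / delta)))%:~R = k%:R :> R.
  by rewrite [RHS]pmulrn gez0_abs// ltW// ceil_gt0.
have skT : (k * s <= T)%N.
  rewrite -(ler_nat R) natrM; apply: le_trans hT.
  rewrite kE mulrAC mulrC ler_wpM2r// truncn_le divr_ge0// ?ltW//.
  rewrite ltr0z ceil_gt0 ln_gt0//; lra.
(* The T - k s leftover steps run first and only change the initial law of the [k] blocks. *)
rewrite -(subnK skT) addnC /law iterD.
apply: (le_trans (iter_contract _ _ (hlaw _))).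
(* Equivalent to e^2 + 2e <= 16, which holds up to e = 3.1. *)
have hc : c <= (expR 1)^-1.
  rewrite -[leRHS]div1r ler_pdivlMr ?expR_gt0// /c.
  have := expR1_le R; have := expR_ge0 (1 : R); nra.
have c0 : 0 <= c by rewrite /c; have := expR_ge0 (1 : R); lra.
rewrite (le_trans (lerXn2r k _ _ hc)) ?nnegrE ?invr_ge0 ?expR_ge0//.
rewrite exprVn -expRM_natr mul1r -[leRHS]invrK lef_pV2 ?posrE ?invr_gt0 ?expR_gt0//.
rewrite -div1r -[leLHS]lnK ?posrE ?div1r ?invr_gt0// ler_expR -kE div1r.
exact: ceil_ge.
Qed.
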